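(* Let $G^{\rm r}$ be the ring graph on $n\ge 3$ nodes, influenced by a mobile intelligent adversary with capability $k$, $1\le k\leq n$. Then $$\alpha^{\rm sus}\left(G^{\rm r},\mathrm{MI}(k)\right) = \begin{cases}\frac{k}{k+1} & \text{if } k\in\{1,2\},\ k\le n-1,\\ \frac{n-1}{n} & \text{if } k\in\{3,\ldots,n-1\},\\ 1 & \text{if } k=n.\end{cases}$$
   Context: Ring graph: $N=\{1,\dots,n\}$, edges $\{i,i+1\}$ with indices mod $n$. Graphical coordination game $(G,\alpha)$, $\alpha\in\mathbb{R}$: agents $N$ each choose an action in $\{x,y\}$; joint action space $\mathcal{A}=\{x,y\}^n$. The two-player payoff is $u(x,x)=1+\alpha$, $u(y,y)=1$, $u(x,y)=u(y,x)=0$. With $\mathcal{N}_i=\{j:\{i,j\}\in E\}$, $U_i(a)=\sum_{j\in\mathcal{N}_i}u(a_i,a_j)$. Write $\vec{x}=(x,\dots,x)$, $\vec{y}=(y,\dots,y)$. Adversarial influence: for an influence set $S\subseteq N$, the influenced utility is $\tilde U_i(a,S)=U_i(a)+1$ if $i\in S$ and $a_i=y$, and $\tilde U_i(a,S)=U_i(a)$ otherwise. A mobile intelligent adversary with capability $k$ (type $\mathrm{MI}(k)$) chooses a policy $S:\mathcal{A}\to\mathcal{S}_k:=\{S'\subseteq N:|S'|=k\}$ (which may depend on $G$ and $\alpha$), and at time $t$ influences the set $S(a(t))$, where $a(t)$ is the current joint action. Log-linear learning with parameter $\beta>0$: at each time $t=0,1,2,\dots$ an agent $i$ is selected uniformly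 at random from $N$; all other agents keep their actions, and agent $i$ chooses its next action to be $x$ with probability $$\frac{e^{\beta \tilde U_i((x,a_{-i}),S(a))}}{e^{\beta \tilde U_i((x,a_{-i}),S(a))}+e^{\beta \tilde U_i((y,a_{-i}),S(a))}}$$ and $y$ otherwise, where $a=a(t)$ is the current joint action. This defines an irreducible aperiodic Markov chain on $\mathcal{A}$ with unique stationary distribution $\pi_\beta$; let $\pi=\lim_{\beta\to\infty}\pi_\beta$. A joint action $a$ is strictly stochastically stable if $\pi(a)=1$. Susceptibility: $(G,\alpha)$ is susceptible to $\mathrm{MI}(k)$ if there is a policy $S:\mathcal{A}\to\mathcal{S}_k$ for which $\vec{y}$ is strictly stochastically stable; $\alpha^{\rm sus}(G,\mathrm{MI}(k))=\sup\{\alpha\in\mathbb{R}: (G,\alpha)\text{ is susceptible to }\mathrm{MI}(k)\}$. *)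

(* Defs.v *)
From HB Require Import structures.
From mathcomp Require Import all_boot all_order all_algebra.
From mathcomp Require Import all_classical all_reals all_analysis.
Import Order.TTheory GRing.Theory Num.Theory.
Import numFieldNormedType.Exports.

Set Implicit Arguments.
Unset Strict Implicit.
Unset Printing Implicit Defensive.

Local Open Scope classical_set_scope.
Local Open Scope ring_scope.

Variant action := ActX | ActY.

Definition bool_of_action (z : action) : bool := if z is ActX then true else false.
Definition action_of_bool (b : bool) : action := if b then ActX else ActY.
Lemma bool_of_actionK : cancel bool_of_action action_of_bool.
Proof. by case. Qed.

HB.instance Definition _ := Finite.copy action (can_type bool_of_actionK).

Definition joint (V : finType) := {ffun V -> action}.

HB.instance Definition _ (V : finType) := Finite.on (joint V).

Definition all_y (V : finType) : joint V := [ffun=> ActY].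

Definition deviate (V : finType) (a : joint V) (i : V) (z : action) : joint V :=
  [ffun j => if j == i then z else a j].

(* A graph is given by its adjacency relation [e]. *)
Section Game.
Variables (R : realType) (V : finType) (e : rel V) (alpha : R).

Definition payoff (z w : action) : R :=
  match z, w with
  | ActX, ActX => 1 + alpha
  | ActY, ActY => 1
  | _, _ => 0
  end.

Definition utility (i : V) (a : joint V) : R :=
  \sum_(j | e i j) payoff (a i) (a j).

Definition infl_utility (i : V) (a : joint V) (S : {set V}) : R :=
  if (i \in S) && (a i == ActY) then utility i a + 1 else utility i a.

Definition MI_policy (k : nat) (S : joint V -> {set V}) : Prop :=
  forall a, #|S a| = k.

Variable S : joint V -> {set V}.

Definition prob_x (beta : R) (a : joint V) (i : V) : R :=
  let wx := expR (beta * infl_utility i (deviate a i ActX) (S a)) in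
  let wy := expR (beta * infl_utility i (deviate a i ActY) (S a)) in
  wx / (wx + wy).

Definition transition (beta : R) (a b : joint V) : R :=
  \sum_(i : V) #|V|%:R^-1 *
    (prob_x beta a i * (b == deviate a i ActX)%:R +
     (1 - prob_x beta a i) * (b == deviate a i ActY)%:R).

Definition stationary (beta : R) (p : joint V -> R) : Prop :=
  [/\ forall a, 0 <= p a,
      \sum_a p a = 1 &
      forall b, \sum_a p a * transition beta a b = p b].

(* For beta > 0 the chain is irreducible, so [pi_ beta] below is the only
   stationary distribution; its values for beta <= 0 are irrelevant. *)
Definition strictly_stochastically_stable (a : joint V) : Prop :=
  exists (pi_ : R -> joint V -> R) (pi_lim : joint V -> R),
    [/\ forall beta, 0 < beta -> stationary beta (pi_ beta),
        forall b, pi_ beta b @[beta --> +oo%R] --> pi_lim b &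
        pi_lim a = 1].

End Game.

Definition susceptible (R : realType) (V : finType) (e : rel V) (k : nat)
    (alpha : R) : Prop :=
  exists S : joint V -> {set V},
    MI_policy k S /\ strictly_stochastically_stable e alpha S (all_y V).

(* The supremum is taken in the extended reals, where it always exists. *)
Definition alpha_sus (R : realType) (V : finType) (e : rel V) (k : nat) : \bar R :=
  ereal_sup [set alpha%:E | alpha in [set alpha : R | susceptible e k alpha]].

(* [ordS] is the cyclic successor on ['I_n]. *)
Definition ring_graph (n : nat) : rel 'I_n :=
  fun i j => (j == ordS i) || (i == ordS j).

(* Main.v *)
Require Import Defs.
From HB Require Import structures.
From mathcomp Require Import all_boot all_order all_algebra.
From mathcomp Require Import all_classical all_reals all_analysis.
From mathcomp Require Import zify ring lra.
Import Order.TTheory GRing.Theory Num.Theory.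
Import numFieldNormedType.Exports.
Local Open Scope ring_scope.

(* Flipping the action of one player costs a number of "errors", the loss of
   influenced utility, and a flip costing c happens at rate about exp(- beta c).
   Leaving all-x costs 1 + 2 alpha.  Leaving all-y costs Q = 2 when some player
   is not influenced and Q = 3 when all are.  A block of x-players grows for free
   unless both of its y-neighbours are influenced, in which case it costs
   1 - alpha.  With k = 1 the adversary cannot influence both; with k = 2 it can,
   but then no x-player is influenced, so that no other exit of the state is
   cheaper than growth and the extra cost counts only for a single x-player, whose
   return to all-y is free; with 3 <= k < n it can guard both ends and still push
   back a boundary x-player, at all sizes up to n - 2.  If J is the number of sizes
   at which growth is costly, all-y is stable iff
     1 + 2 alpha < Q + J (1 - alpha).
   When this fails, a lower bound for the stationary flow along a path from all-y
   to all-x yields p(all-x) >= c p(all-y) uniformly in beta.  When it holds, a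
   Lyapunov function whose drift is at most -1/2 off all-y, and exponentially small
   at all-y, shows that the stationary mass concentrates on all-y. *)

Set Implicit Arguments.
Unset Strict Implicit.
Unset Printing Implicit Defensive.

(** * Stationary distributions of finite stochastic matrices *)

Lemma ler_sum_eq (R : numDomainType) (T : finType) (F G : T -> R) :
  (forall i, F i <= G i) -> \sum_i F i = \sum_i G i -> forall i, F i = G i.
Proof.
move=> leFG eqFG i; apply/eqP; rewrite eq_sym -subr_eq0.
have /eqP : \sum_j (G j - F j) = 0 by rewrite sumrB eqFG subrr.
rewrite psumr_eq0 => [/allP/(_ i)|j _]; last by rewrite subr_ge0.
by rewrite mem_index_enum => /(_ isT).
Qed.

(* A nonzero left fixed vector of P exists because P - 1 kills the all-one
   column; its entrywise absolute value is still fixed, since |v| P >= |v|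
   entrywise while both sides have the same mass. *)
Lemma stochastic_stationary (R : realFieldType) (T : finType) (P : T -> T -> R) :
  (0 < #|T|)%N -> (forall a b, 0 <= P a b) -> (forall a, \sum_b P a b = 1) ->
  exists p : T -> R, [/\ forall a, 0 <= p a, \sum_a p a = 1 &
    forall b, \sum_a p a * P a b = p b].
Proof.
move=> T_gt0 P_ge0 P_sum.
pose M : 'M[R]_#|T| := \matrix_(i, j) P (enum_val i) (enum_val j) - 1%:M.
have sum_val (F : T -> R) : \sum_(i < #|T|) F (enum_val i) = \sum_a F a.
  by rewrite [RHS](reindex _ (onW_bij _ (@enum_val_bij T))).
have M1 : M *m (\col_j 1 : 'cV[R]_#|T|) = 0.
  apply/colP => i; rewrite mulmxBl mul1mx !mxE.
  under eq_bigr => j _ do rewrite !mxE mulr1.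
  by rewrite sum_val P_sum subrr.
have detM : \det M = 0.
  apply/eqP; apply: contraT => /negbTE detM.
  have Mu : M \in unitmx by rewrite unitmxE unitfE detM.
  have := congr1 (mulmx (invmx M)) M1; rewrite mulKmx // mulmx0.
  move=> /colP/(_ (Ordinal T_gt0)); rewrite !mxE => /eqP.
  by rewrite oner_eq0.
have /det0P[v v_neq0 vM] : \det M == 0 by rewrite detM.
pose w a := v 0 (enum_rank a).
have wP b : \sum_a w a * P a b = w b.
  have /rowP/(_ (enum_rank b)) := vM.
  rewrite mulmxBr mulmx1 !mxE => /eqP; rewrite subr_eq0 /w => /eqP <-.
  rewrite -sum_val; apply: eq_bigr => i _.
  by rewrite enum_valK mxE enum_rankK.
have nwP : forall b, `|w b| = \sum_a `|w a| * P a b.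
  apply: ler_sum_eq => [b|].
    rewrite -wP (le_trans (ler_norm_sum _ _ _)) //.
    by apply: ler_sum => a _; rewrite normrM (ger0_norm (P_ge0 _ _)).
  rewrite exchange_big /=; apply: eq_bigr => a _.
  by rewrite -mulr_sumr P_sum mulr1.
have s_gt0 : 0 < \sum_a `|w a|.
  have /rV0Pn[i vi] := v_neq0; rewrite (bigD1 (enum_val i)) //=.
  by rewrite ltr_wpDr ?sumr_ge0 // /w enum_valK normr_gt0.
exists (fun a => `|w a| / \sum_a `|w a|); split => [a||b].
- by rewrite divr_ge0 // ltW.
- by rewrite -mulr_suml divff ?gt_eqF.
- by rewrite nwP mulr_suml; apply: eq_bigr => a _; rewrite mulrAC.
Qed.

(** * The flip rates of log-linear learning *)

Section Rates.
Variables (R : realType) (V : finType) (e : rel V) (alpha : R).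
Variables (S : joint V -> {set V}) (beta : R).

Definition is_x (a : joint V) (i : V) : bool := a i == ActX.

Definition flip (a : joint V) (i : V) : joint V :=
  deviate a i (if is_x a i then ActY else ActX).

(** This probability is conditional on [i] being selected; the selection factor [#|V|^-1] is kept
    apart. *)
Definition flip_rate (a : joint V) (i : V) : R :=
  if is_x a i then 1 - prob_x e alpha S beta a i else prob_x e alpha S beta a i.

Lemma is_xPn (a : joint V) i : (a i == ActY) = ~~ is_x a i.
Proof. by rewrite /is_x; case: (a i). Qed.

Lemma joint_eqP (a b : joint V) : is_x a =1 is_x b -> a = b.
Proof.
move=> ab; apply/ffunP => i; have := ab i; rewrite /is_x.
by case: (a i); case: (b i).
Qed.

Lemma deviate_id (a : joint V) i z : a i = z -> deviate a i z = a.
Proof. by move=> az; apply/ffunP => j; rewrite ffunE; case: eqP => // ->. Qed.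

Lemma is_x_flip a i j : is_x (flip a i) j = (j == i) (+) is_x a j.
Proof.
rewrite /flip {1}/is_x ffunE; have [->|//] := eqVneq j i.
by rewrite /is_x; case: (a i).
Qed.

Lemma flip_neq a i : flip a i != a.
Proof.
apply/eqP => /(congr1 (is_x^~ i)); rewrite is_x_flip eqxx /=.
by case: (is_x a i).
Qed.

Lemma prob_x_ge0 a i : 0 <= prob_x e alpha S beta a i.
Proof. by rewrite divr_ge0 ?addr_ge0 ?expR_ge0. Qed.

Lemma prob_x_le1 a i : prob_x e alpha S beta a i <= 1.
Proof.
rewrite ler_pdivrMr ?addr_gt0 ?expR_gt0 // mul1r lerDl.
exact: expR_ge0.
Qed.

Lemma rate_ge0 a i : 0 <= flip_rate a i.
Proof. by rewrite /flip_rate; case: ifP; rewrite ?subr_ge0 ?prob_x_le1 ?prob_x_ge0. Qed.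

Lemma rate_le1 a i : flip_rate a i <= 1.
Proof. by rewrite /flip_rate; case: ifP; rewrite ?gerBl ?prob_x_le1 ?prob_x_ge0. Qed.

(** The one-step operator is the identity plus [#|V|^-1] times a generator: deviating to the action
    already played changes nothing, so only the flips contribute. *)
Lemma transition_sum a (f : joint V -> R) : (0 < #|V|)%N ->
  \sum_b transition e alpha S beta a b * f b =
  f a + #|V|%:R^-1 * \sum_i flip_rate a i * (f (flip a i) - f a).
Proof.
move=> V_gt0; have Vu : #|V|%:R != 0 :> R by rewrite pnatr_eq0 -lt0n.
rewrite /transition.
under eq_bigr => b _ do rewrite mulr_suml.
rewrite exchange_big /=.
have sum_at c : \sum_b (b == c)%:R * f b = f c.
  rewrite (bigD1 c) //= eqxx mul1r big1 ?addr0 // => b /negbTE ->.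
  by rewrite mul0r.
transitivity (\sum_(i : V) (#|V|%:R^-1 * f a +
    #|V|%:R^-1 * (flip_rate a i * (f (flip a i) - f a)))).
  apply: eq_bigr => i _.
  under eq_bigr => b _ do rewrite -mulrA mulrDl -!(mulrA _ (_ == _)%:R).
  rewrite -mulr_sumr big_split /= -!mulr_sumr !sum_at -mulrDr; congr (_ * _).
  rewrite /flip_rate /flip; case: ifP => aiX.
    by rewrite (deviate_id (eqP aiX)); ring.
  rewrite [deviate a i ActY]deviate_id; first by ring.
  by apply/eqP; rewrite is_xPn aiX.
rewrite big_split /= -mulr_suml -mulr_sumr; congr (_ + _).
by rewrite sumr_const -(mulr_natr _ #|V|) mulVf ?mul1r.
Qed.

Lemma transition_ge0 a b : 0 <= transition e alpha S beta a b.
Proof.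
apply: sumr_ge0 => i _; rewrite mulr_ge0 ?invr_ge0 // addr_ge0 // mulr_ge0 //.
  exact: prob_x_ge0.
by rewrite subr_ge0 prob_x_le1.
Qed.

Lemma stationary_exists : (0 < #|V|)%N ->
  exists p, stationary e alpha S beta p.
Proof.
move=> V_gt0.
have [||a|p [p0 p1 pP]] := @stochastic_stationary R (joint V) (transition e alpha S beta).
- by apply/card_gt0P; exists (all_y V).
- exact: transition_ge0.
- have := transition_sum a (fun=> 1) V_gt0.
  under eq_bigr do rewrite mulr1; move=> ->.
  by rewrite big1 ?mulr0 ?addr0 // => i _; rewrite subrr mulr0.
- by exists p.
Qed.

Variable p : joint V -> R.
Hypotheses (V_gt0 : (0 < #|V|)%N) (p_stat : stationary e alpha S beta p).

(** Stationarity tested against [f]: the mean drift of [f] vanishes. Indicators [f] give flow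
    bounds, the Lyapunov function gives concentration. *)
Lemma balance (f : joint V -> R) :
  \sum_a p a * \sum_i flip_rate a i * (f (flip a i) - f a) = 0.
Proof.
have [_ _ pP] := p_stat.
have Vu : #|V|%:R^-1 != 0 :> R by rewrite invr_eq0 pnatr_eq0 -lt0n.
apply: (mulfI Vu); rewrite mulr0 mulr_sumr.
transitivity (\sum_a (p a * (\sum_b transition e alpha S beta a b * f b) - p a * f a)).
  by apply: eq_bigr => a _; rewrite transition_sum //; ring.
rewrite sumrB; apply/eqP; rewrite subr_eq0; apply/eqP.
under eq_bigr do rewrite mulr_sumr.
rewrite exchange_big /=; apply: eq_bigr => b _.
by rewrite -(pP b) mulr_suml; apply: eq_bigr => a _; rewrite mulrA.
Qed.

(** [balance] for the indicator of [flip a i] equates total inflow and total outflow of that state,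
    and the flow from [a] is one nonnegative term of the inflow. *)
Lemma inflow_le_outflow a i :
  p a * flip_rate a i <= p (flip a i) * \sum_j flip_rate (flip a i) j.
Proof.
have [p0 _ _] := p_stat.
pose b := flip a i; have := balance (fun c => (c == b)%:R).
rewrite (bigD1 b) //= (bigD1 a) /=; last by rewrite eq_sym flip_neq.
rewrite -/b; set o := (X in _ + (_ + X)).
have -> : \sum_j flip_rate b j * ((flip b j == b)%:R - (b == b)%:R) =
    - \sum_j flip_rate b j.
  rewrite -sumrN; apply: eq_bigr => j _.
  by rewrite (negbTE (flip_neq _ _)) eqxx sub0r mulrN1.
have o_ge0 : 0 <= o.
  apply: sumr_ge0 => c /andP[/negbTE -> _]; rewrite mulr_ge0 ?sumr_ge0 // => j _.
  by rewrite subr0 mulr_ge0 ?rate_ge0.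
have a_ge : p a * flip_rate a i <= p a * \sum_j flip_rate a j * ((flip a j == b)%:R - (a == b)%:R).
  rewrite ler_wpM2l // (bigD1 i) //= eqxx [a == b]eq_sym (negbTE (flip_neq _ _)).
  rewrite subr0 mulr1 lerDl sumr_ge0 // => j _.
  by rewrite subr0 mulr_ge0 ?rate_ge0.
by rewrite mulrN; lra.
Qed.

End Rates.

(** * Rates and configurations on the ring *)

Lemma iter_ordS n (i : 'I_n) m : val (iter m (@ordS n) i) = ((i + m) %% n)%N.
Proof.
elim: m => [|m IH]; first by rewrite addn0 modn_small.
by rewrite iterS /= IH -(addn1 (_ %% _)) modnDml addn1 addnS.
Qed.

Lemma ordS_closed n (P : pred 'I_n) (i j : 'I_n) :
  (forall l, P l -> P (ordS l)) -> P i -> P j.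
Proof.
(* Going once past the end of the ring keeps the number of steps from [i] to [j] free of negative
   differences. *)
move=> PS Pi; suff -> : j = iter (n - i + j) (@ordS n) i.
  by elim: (n - i + j)%N => //= m; exact: PS.
apply: val_inj; rewrite iter_ordS addnA subnKC ?(ltnW (ltn_ord i)) //.
by rewrite modnDl modn_small.
Qed.

Definition all_x (V : finType) : joint V := [ffun=> ActX].

Lemma is_x_all_x (V : finType) i : is_x (all_x V) i.
Proof. by rewrite /is_x ffunE. Qed.

Lemma is_x_all_y (V : finType) i : is_x (all_y V) i = false.
Proof. by rewrite /is_x ffunE. Qed.

Section Ring.
Variable n : nat.
Implicit Types (a : joint 'I_n) (i j : 'I_n).

Let ring := @ring_graph n.

Definition next_x a i : nat := is_x a (ordS i) + is_x a (ord_pred i).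

Definition num_x a : nat := \sum_i is_x a i.

(* Number of maximal blocks of consecutive x-players, unless all play x. *)
Definition blocks a : nat := \sum_i (is_x a i && ~~ is_x a (ordS i)).

Lemma num_x_le a : (num_x a <= n)%N.
Proof.
rewrite -[X in (_ <= X)%N]card_ord -sum1_card.
by apply: leq_sum => i _; case: is_x.
Qed.

Lemma num_x_eq0 a : num_x a = 0%N -> a = all_y 'I_n.
Proof.
move=> /eqP; rewrite sum_nat_eq0 => /forallP a0; apply: joint_eqP => i.
by rewrite is_x_all_y; have := a0 i; case: is_x.
Qed.

Lemma num_x_eqn a : num_x a = n -> a = all_x 'I_n.
Proof.
move=> an; apply: joint_eqP => i; rewrite is_x_all_x.
have : (\sum_i (~~ is_x a i) = 0)%N.
  apply/eqP; rewrite -(eqn_add2l (num_x a)) -big_split /= addn0 an.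
  rewrite -[X in _ == X]card_ord -sum1_card; apply/eqP/eq_bigr => j _.
  by case: is_x.
move=> /eqP; rewrite sum_nat_eq0 => /forallP/(_ i).
by case: is_x.
Qed.

Lemma num_x_all_x : num_x (all_x 'I_n) = n.
Proof.
rewrite -[RHS]card_ord -sum1_card; apply: eq_bigr => i _.
by rewrite is_x_all_x.
Qed.

Lemma num_x_all_y : num_x (all_y 'I_n) = 0%N.
Proof. by rewrite /num_x big1 // => i _; rewrite is_x_all_y. Qed.

Lemma num_x_flip a i : (num_x (flip a i) + is_x a i = num_x a + ~~ is_x a i)%N.
Proof.
rewrite /num_x (bigD1 i) // [in RHS](bigD1 i) //=.
rewrite is_x_flip eqxx addTb.
under eq_bigr => j /negbTE ji do rewrite is_x_flip ji /=.
by lia.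
Qed.

Lemma num_x_flip_x a i : is_x a i -> num_x a = (num_x (flip a i)).+1.
Proof. by have := num_x_flip a i; case: is_x => //=; lia. Qed.

Lemma num_x_flip_y a i : ~~ is_x a i -> num_x (flip a i) = (num_x a).+1.
Proof. by have := num_x_flip a i; case: is_x => //=; lia. Qed.

(** Without a block end the set of x-players is closed under the successor, hence empty or
    everything. *)
Lemma blocks_eq0 a : blocks a = 0%N -> a = all_x 'I_n \/ a = all_y 'I_n.
Proof.
move=> /eqP; rewrite sum_nat_eq0 => /forallP a0.
have aS l : is_x a l -> is_x a (ordS l).
  by have := a0 l; case: is_x => //=; case: is_x.
have [/existsP[i ai]|/existsPn a_y] := boolP [exists i, is_x a i].
  by left; apply: joint_eqP => j; rewrite is_x_all_x; exact: (@ordS_closed _ (is_x a) i).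
by right; apply: joint_eqP => j; rewrite is_x_all_y; exact/negbTE.
Qed.

Lemma blocks_all_y : blocks (all_y 'I_n) = 0%N.
Proof. by rewrite /blocks big1 // => i _; rewrite is_x_all_y. Qed.

Lemma exists_xy a : a != all_x 'I_n -> a != all_y 'I_n ->
  exists i, is_x a i /\ ~~ is_x a (ordS i).
Proof.
move=> ax ay; have [/existsP[i /andP[]]|/existsPn a0] :=
  boolP [exists i, is_x a i && ~~ is_x a (ordS i)]; first by exists i.
have : blocks a = 0%N.
  by apply: big1 => i _; apply/eqP; rewrite eqb0; exact: a0.
by move=> /blocks_eq0[] E; move: ax ay; rewrite E eqxx.
Qed.

(** After adding the number of edges with both ends in x, either side counts all x-players, once as
    right ends of edges and once as left ends. *)
Lemma blocks_yx a : (\sum_i (~~ is_x a i && is_x a (ordS i)) = blocks a)%N.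
Proof.
apply/eqP; rewrite -(eqn_add2r (\sum_i (is_x a i && is_x a (ordS i)))).
rewrite -!big_split /=.
rewrite [X in _ == X](eq_bigr (fun i => is_x a i : nat)); last first.
  by move=> i _; case: is_x; case: is_x.
rewrite (eq_bigr (fun i => is_x a (ordS i) : nat)); last first.
  by move=> i _; case: is_x; case: is_x.
by rewrite [X in _ == X](reindex (@ordS n) (onW_bij _ (@ordS_bij n))) /=.
Qed.

Lemma exists_yx a : a != all_x 'I_n -> a != all_y 'I_n ->
  exists i, ~~ is_x a i /\ is_x a (ordS i).
Proof.
move=> ax ay; have [/existsP[i /andP[]]|/existsPn a0] :=
  boolP [exists i, ~~ is_x a i && is_x a (ordS i)]; first by exists i.
have : blocks a = 0%N.
  by rewrite -blocks_yx; apply: big1 => i _; apply/eqP; rewrite eqb0; exact: a0.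
by move=> /blocks_eq0[] E; move: ax ay; rewrite E eqxx.
Qed.

Definition frontier a : {set 'I_n} := [set i | ~~ is_x a i & (0 < next_x a i)%N].

(** A frontier player is the y-end of a yx-edge or of an xy-edge, and there are [blocks a] edges of
    each kind. *)
Lemma card_frontier a : (#|frontier a| <= (blocks a).*2)%N.
Proof.
apply: (@leq_trans (\sum_i ((~~ is_x a i && is_x a (ordS i)) +
    (~~ is_x a i && is_x a (ord_pred i))))%N).
  rewrite -sum1_card big_mkcond /=; apply: leq_sum => i _.
  rewrite inE /next_x; case: is_x => //=; by do 2 case: is_x.
rewrite big_split /= blocks_yx -addnn leq_add2l.
rewrite (reindex (@ordS n) (onW_bij _ (@ordS_bij n))) /=.
by apply: leq_sum => i _; rewrite ordSK andbC.
Qed.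

Hypothesis n_ge3 : (3 <= n)%N.

Lemma ordS_neq i : ordS i != i.
Proof.
rewrite -val_eqE /=; have := ltn_ord i; rewrite leq_eqVlt => /orP[/eqP iE|lt].
  by rewrite iE modnn; apply/eqP => i0; move: n_ge3; rewrite -iE -i0.
by rewrite modn_small // gtn_eqF.
Qed.

Lemma ord_pred_neq i : ord_pred i != i.
Proof. by rewrite -(inj_eq (@ordS_inj n)) ord_predK eq_sym ordS_neq. Qed.

Lemma ordS_neq_pred i : ordS i != ord_pred i.
Proof.
rewrite -(inj_eq (@ordS_inj n)) ord_predK; apply/eqP => /(congr1 val).
rewrite -/(iter 2 (@ordS n) i) iter_ordS => /eqP.
rewrite -[X in _ == X](modn_small (ltn_ord i)).
rewrite -[X in _ == X %[mod n]](addn0 (val i)) eqn_modDl.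
by rewrite !modn_small //; apply: leq_trans n_ge3.
Qed.

(** Only the two edges at [i] change their contribution. The identity is additive to avoid truncated
    subtraction. *)
Lemma blocks_flip a i :
  (blocks (flip a i) + (is_x a i && ~~ is_x a (ordS i)) +
     (is_x a (ord_pred i) && ~~ is_x a i) =
   blocks a + (~~ is_x a i && ~~ is_x a (ordS i)) +
     (is_x a (ord_pred i) && is_x a i))%N.
Proof.
have ipi : ord_pred i != i by exact: ord_pred_neq.
rewrite /blocks (bigD1 i) // (bigD1 (ord_pred i)) //=.
rewrite [in RHS](bigD1 i) // [in RHS](bigD1 (ord_pred i)) //=.
rewrite ord_predK !is_x_flip eqxx (negbTE (ordS_neq i)) (negbTE ipi) /= negbK.
under eq_bigr => j /andP[/negbTE ji jpi].
  rewrite !is_x_flip ji.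
  have -> : (ordS j == i) = false.
    by apply: contraNF jpi => /eqP <-; rewrite ordSK.
  rewrite !addFb; over.
by lia.
Qed.

Section RingRates.
Variables (R : realType) (alpha : R) (S : joint 'I_n -> {set 'I_n}) (beta : R).

Lemma utility_deviate a i z : utility ring alpha i (deviate a i z) =
  payoff alpha z (a (ordS i)) + payoff alpha z (a (ord_pred i)).
Proof.
rewrite /utility (bigD1 (ordS i)) /=; last by rewrite /ring /ring_graph eqxx.
rewrite (bigD1 (ord_pred i)) /=; last first.
  by rewrite /ring /ring_graph ord_predK eqxx orbT /= eq_sym ordS_neq_pred.
rewrite big1 ?addr0 => [|j /andP[/andP[/orP[/eqP->|/eqP->]]]]; last 2 first.
- by rewrite eqxx.
- by rewrite ordSK eqxx.
by rewrite !ffunE eqxx (negbTE (ordS_neq i)) (negbTE (ord_pred_neq i)).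
Qed.

(* Increase of the influenced utility of i when it flips. *)
Definition gain a i : R :=
  let d := (next_x a i)%:R * (2 + alpha) - 2 - (i \in S a)%:R in
  if is_x a i then - d else d.

Notation rate := (flip_rate ring alpha S beta).

(** The choice rule is the logistic function of the utility difference, and one minus the logistic
    function only changes the sign of its argument. *)
Lemma rateE a i : rate a i = (1 + expR (- (beta * gain a i)))^-1.
Proof.
have probE : prob_x ring alpha S beta a i = (1 + expR (- (beta *
    ((next_x a i)%:R * (2 + alpha) - 2 - (i \in S a)%:R))))^-1.
  rewrite /prob_x /infl_utility !utility_deviate !ffunE eqxx andbF andbT.
  set ux := _ + _; set uy := (if _ then _ else _).
  have -> : - (beta * ((next_x a i)%:R * (2 + alpha) - 2 - (i \in S a)%:R)) =
      beta * uy - beta * ux.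
    rewrite -mulrBr -mulrN; congr (_ * _); rewrite /uy /ux /next_x /is_x.
    by case: (i \in S a); case: (a (ordS i)); case: (a (ord_pred i)) => /=; ring.
  rewrite expRB; have /lt0r_neq0 := expR_gt0 (beta * ux).
  have := expR_gt0 (beta * ux); have := expR_gt0 (beta * uy).
  move: (expR _) (expR _) => X Y X0 Y0 Yn; field.
  by rewrite Yn gt_eqF // addr_gt0.
rewrite /flip_rate /gain probE; case: is_x => //; set d := _ - (i \in S a)%:R.
rewrite mulrN opprK expRN; have := expR_gt0 (beta * d).
move: (expR _) => X X0; field.
by rewrite !gt_eqF // addr_gt0.
Qed.

Lemma rate_le a i d : 0 <= beta -> gain a i <= d -> rate a i <= expR (beta * d).
Proof.
move=> b0 gd; rewrite rateE; apply: (@le_trans _ _ (expR (beta * gain a i))).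
  rewrite -[leRHS]invrK -expRN lef_pV2 ?posrE ?addr_gt0 ?expR_gt0 //.
  by rewrite lerDr.
by rewrite ler_expR ler_wpM2l.
Qed.

Lemma rate_ge a i d : 0 <= beta -> 0 <= d -> - d <= gain a i ->
  expR (- (beta * d)) / 2 <= rate a i.
Proof.
move=> b0 d0 gd; rewrite rateE expRN -invfM.
rewrite lef_pV2 ?posrE ?addr_gt0 ?mulr_gt0 ?expR_gt0 //.
(* Both summands of the logistic denominator are at most [expR (beta * d)]. *)
rewrite mulr2n mulrDr mulr1 lerD //; first by rewrite -expR0 ler_expR mulr_ge0.
by rewrite ler_expR -mulrN ler_wpM2l // lerNl.
Qed.

Lemma rate_ge_half a i : 0 <= beta -> 0 <= gain a i -> 2^-1 <= rate a i.
Proof.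
move=> b0 g0; have := @rate_ge a i 0 b0 (lexx _).
by rewrite mulr0 oppr0 expR0 mul1r; apply.
Qed.

End RingRates.

End Ring.

(** * Threshold from above: the flow from all-y to all-x *)

Lemma all_xDy n : (0 < n)%N -> all_x 'I_n != all_y 'I_n.
Proof.
move=> n0; apply/eqP => /(congr1 (fun a => is_x a (Ordinal n0))).
by rewrite is_x_all_x is_x_all_y.
Qed.

Lemma sum_ord_le (R : numDomainType) n (F : 'I_n -> R) (C : R) :
  (forall i, F i <= C) -> \sum_i F i <= n%:R * C.
Proof.
move=> FC; apply: le_trans (ler_sum _ (fun i _ => FC i)) _.
by rewrite sumr_const card_ord mulr_natl.
Qed.

Lemma num_x_between n (a : joint 'I_n) : (0 < num_x a < n)%N ->
  a != all_x 'I_n /\ a != all_y 'I_n.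
Proof.
by move=> /andP[a0 an]; split; apply/eqP => E; move: a0 an;
  rewrite E ?num_x_all_x ?num_x_all_y ?ltnn.
Qed.

(** The ratio bound is uniform in beta, so it survives in the limit: all-x would keep mass at least
    [c] while all-y already has mass 1. *)
Lemma not_stable_of_ratio (R : realType) n (alpha : R) S (c : R) :
  (3 <= n)%N -> 0 < c ->
  (forall beta p, 0 < beta -> stationary (@ring_graph n) alpha S beta p ->
     c * p (all_y _) <= p (all_x _)) ->
  ~ strictly_stochastically_stable (@ring_graph n) alpha S (all_y _).
Proof.
move=> n_ge3 c0 ratio [p [pl [p_stat p_cvg pl_y]]].
have le_x : c <= pl (all_x _).
  rewrite -[c]mulr1 -pl_y.
  apply: (ler_cvg_to (cvgM (cvg_cst c) (p_cvg (all_y _))) (p_cvg (all_x _))).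
  by near=> b; apply: (ratio b); [|apply: p_stat]; near: b; exact: nbhs_pinfty_gt.
have : pl (all_y _) + pl (all_x _) <= 1.
  apply: (cvgr_to_le (cvgD (p_cvg (all_y _)) (p_cvg (all_x _)))).
  near=> b; have b0 : 0 < b by near: b; exact: nbhs_pinfty_gt.
  have [p0 p1 _] := p_stat b b0.
  have n_gt0 : (0 < n)%N by rewrite (ltn_trans _ n_ge3).
  rewrite -[leRHS]p1 (bigD1 (all_y 'I_n)) // (bigD1 (all_x 'I_n)) ?all_xDy //=.
  by rewrite addrA lerDl sumr_ge0.
by rewrite pl_y; lra.
Unshelve. all: by end_near.
Qed.

Section Flow.
Variables (R : realType) (n : nat) (n_ge3 : (3 <= n)%N).
Variables (alpha : R) (S : joint 'I_n -> {set 'I_n}) (beta : R).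
Hypothesis beta_ge0 : 0 <= beta.
Implicit Types (a b : joint 'I_n) (i j : 'I_n).

Notation rate := (flip_rate (@ring_graph n) alpha S beta).
Notation gain := (gain alpha S).

Lemma sum_rate_le a : \sum_i rate a i <= n%:R.
Proof. by rewrite -[leRHS]mulr1; apply: sum_ord_le => i; exact: rate_le1. Qed.

Lemma next_x_all_x i : next_x (all_x 'I_n) i = 2%N.
Proof. by rewrite /next_x !is_x_all_x. Qed.

Lemma next_x_all_y i : next_x (all_y 'I_n) i = 0%N.
Proof. by rewrite /next_x !is_x_all_y. Qed.

Lemma sum_rate_all_x :
  \sum_i rate (all_x _) i <= n%:R * expR (- (beta * (1 + 2 * alpha))).
Proof.
apply: sum_ord_le => i; rewrite -mulrN; apply: rate_le => //.
rewrite /gain is_x_all_x next_x_all_x.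
by case: (i \in _) => /=; lra.
Qed.

(** The path adds one x-player at a time through good states. At each state the outflow is at least
    the flow along the edge just taken, and the next edge carries a fixed fraction of that outflow:
    [h / N] at sizes up to [J], [N^-1] above. At the end the flow is compared with the exit rate of
    all-x. *)
Lemma flow_to_all_x p (good : joint 'I_n -> Prop) (h f0 N : R) (J : nat) i0 :
  stationary (@ring_graph n) alpha S beta p ->
  0 < N -> 0 <= h <= 1 -> 0 <= f0 -> good (flip (all_y _) i0) ->
  f0 <= rate (all_y _) i0 ->
  (forall b, (0 < num_x b < n)%N -> good b -> exists j,
     [/\ ~~ is_x b j, good (flip b j) &
      h ^+ (num_x b <= J)%N / N * \sum_i rate b i <= rate b j]) ->
  p (all_y _) * f0 * (h ^+ J / N ^+ n.-1) <=
    p (all_x _) * (n%:R * expR (- (beta * (1 + 2 * alpha)))).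
Proof.
move=> p_stat n0 /andP[h0 h1] f00 good0 rate0 step.
have [p0 _ _] := p_stat.
have n_gt0 : (0 < n)%N by rewrite (ltn_trans _ n_ge3).
(* Among the sizes 1 to l passed so far, [minn l J] have cost a factor [h]. *)
have inv l : (l < n)%N -> exists a i, [/\ ~~ is_x a i, num_x a = l, good (flip a i) &
    p (all_y _) * f0 * (h ^+ (minn l J) / N ^+ l) <= p a * rate a i].
  elim: l => [|l IH] ln.
    exists (all_y _), i0; rewrite is_x_all_y num_x_all_y; split => //.
    by rewrite min0n !expr0 divr1 mulr1 ler_wpM2l.
  have [a [i [aiX al good_ai le_ai]]] := IH (ltnW ln).
  have bl : num_x (flip a i) = l.+1 by rewrite num_x_flip_y ?al.
  have [||j []] := step (flip a i); rewrite ?bl // => bjX good_bj le_bj.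
  exists (flip a i), j; split; [exact: bjX|exact: bl|exact: good_bj|].
  apply: (@le_trans _ _ (p (flip a i) * (h ^+ (l.+1 <= J)%N / N *
    \sum_i0 rate (flip a i) i0))); last by apply: ler_wpM2l le_bj.
  rewrite [leRHS]mulrCA.
  have -> : p (all_y _) * f0 * (h ^+ (minn l.+1 J) / N ^+ l.+1) =
      h ^+ (l.+1 <= J)%N / N *
      (p (all_y _) * f0 * (h ^+ (minn l J) / N ^+ l)).
    have -> : minn l.+1 J = ((l.+1 <= J) + minn l J)%N by clear; lia.
    rewrite exprD exprS; field.
    by rewrite expf_neq0 ?gt_eqF.
  rewrite ler_wpM2l ?divr_ge0 ?exprn_ge0 ?(ltW n0) //.
  by apply: (le_trans le_ai); apply: inflow_le_outflow; rewrite ?card_ord.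
have [|a [i [aiX an _ le_ai]]] := inv n.-1; first by rewrite prednK.
have flip_x : flip a i = all_x _ by apply: num_x_eqn; rewrite num_x_flip_y ?an ?prednK.
apply: (@le_trans _ _ (p a * rate a i)); last first.
  apply: (@le_trans _ _ (p (flip a i) * \sum_j rate (flip a i) j)).
    by apply: inflow_le_outflow; rewrite ?card_ord.
  by rewrite flip_x ler_wpM2l // sum_rate_all_x.
apply: le_trans le_ai; rewrite ler_wpM2l ?mulr_ge0 //.
rewrite ler_wpM2r ?invr_ge0 ?exprn_ge0 ?(ltW n0) //.
by apply: ler_wiXn2l => //; rewrite geq_minr.
Qed.

(** With [h = expR (- (beta * r))] the threshold inequality says that the exponential cost of the
    path is at most that of leaving all-x, so beta cancels and only powers of [2 * n] remain. *)
Lemma ratio_of_flow p (good : joint 'I_n -> Prop) (Q : R) (J : nat) (r : R) i0 :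
  stationary (@ring_graph n) alpha S beta p ->
  0 <= r -> Q + J%:R * r <= 1 + 2 * alpha -> good (flip (all_y _) i0) ->
  expR (- (beta * Q)) / 2 <= rate (all_y _) i0 ->
  (forall b, (0 < num_x b < n)%N -> good b -> exists j,
     [/\ ~~ is_x b j, good (flip b j) &
      expR (- (beta * r)) ^+ (num_x b <= J)%N / (2 * n%:R) *
        \sum_i rate b i <= rate b j]) ->
  ((2 * n%:R) ^+ n)^-1 * p (all_y _) <= p (all_x _).
Proof.
move=> p_stat r0 QJ good0 rate0 step.
have [p0 _ _] := p_stat.
have n_gt0 : (0 < n)%N by rewrite (ltn_trans _ n_ge3).
have n0 : 0 < n%:R :> R by rewrite ltr0n.
have h01 : 0 <= expR (- (beta * r)) <= 1.
  by rewrite expR_ge0 expR_le1 oppr_le0 mulr_ge0.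
have f00 : 0 <= expR (- (beta * Q)) / 2 by rewrite divr_ge0 ?expR_ge0.
have N0 : 0 < 2 * n%:R :> R by rewrite mulr_gt0.
have := flow_to_all_x p_stat N0 h01 f00 good0 rate0 step.
rewrite -expRM_natl.
set x := expR (- (beta * (1 + 2 * alpha))).
set y := expR (- (beta * Q)); set z := expR (_ * _) => le_flow.
have x0 : 0 < x by exact: expR_gt0.
have xyz : x <= y * z.
  rewrite -expRD ler_expR.
  have := ler_wpM2l beta_ge0 QJ; lra.
rewrite -(ler_pM2r (mulr_gt0 n0 x0)); apply: le_trans le_flow.
have -> : (2 * n%:R) ^+ n = 2 * n%:R * (2 * n%:R) ^+ n.-1 :> R.
  by rewrite -exprS prednK.
set w := (2 * n%:R) ^+ n.-1.
have w0 : 0 < w by rewrite exprn_gt0 // mulr_gt0.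
have -> : (2 * n%:R * w)^-1 * p (all_y _) * (n%:R * x) = p (all_y _) / (2 * w) * x.
  by field; rewrite !gt_eqF.
have -> : p (all_y _) * (y / 2) * (z / w) = p (all_y _) / (2 * w) * (y * z).
  by field; rewrite !gt_eqF.
by rewrite ler_wpM2l // divr_ge0 // mulr_ge0 // ltW.
Qed.

(* For alpha >= 1 an x-player is copied by its y-neighbour even if the latter
   is influenced. *)
Lemma ratio_alpha_ge1 p : stationary (@ring_graph n) alpha S beta p ->
  1 <= alpha -> ((2 * n%:R) ^+ n)^-1 * p (all_y _) <= p (all_x _).
Proof.
move=> p_stat alpha1; have n_gt0 : (0 < n)%N by rewrite (ltn_trans _ n_ge3).
(* Leaving all-y costs at most 3, even under influence, and growth is always free;
   [3 <= 1 + 2 * alpha] is the assumption. *)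
apply: (@ratio_of_flow p (fun=> True) 3 0 0 (Ordinal n_gt0)) => //.
- by lra.
- apply: rate_ge => //.
  by rewrite /gain is_x_all_y next_x_all_y; case: (_ \in _) => /=; lra.
move=> b /num_x_between[bx by_] _.
have [j [bjX bjSX]] := exists_yx bx by_; exists j; split => //.
rewrite mulr0 oppr0 expR0 expr1n.
apply: (@le_trans _ _ 2^-1).
  have := sum_rate_le b; have : 0 < n%:R :> R by rewrite ltr0n.
  move: (\sum_i _) n%:R => s m m0 sm.
  by rewrite mul1r mulrC ler_pdivrMr ?mulr_gt0 // mulrA mulVf ?mul1r.
apply: rate_ge_half => //; rewrite /gain (negbTE bjX) /next_x bjSX.
by case: is_x; case: (_ \in _) => /=; lra.
Qed.

End Flow.

(** * Growth of x against an adversary with k < n *)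

Lemma num_x_le_y2 n (b : joint 'I_n) i j : (3 <= n)%N ->
  i != j -> ~~ is_x b i -> ~~ is_x b j -> (num_x b <= n - 2)%N.
Proof.
move=> n_ge3 ij bi bj; have := num_x_le (flip (flip b i) j).
rewrite !num_x_flip_y ?is_x_flip //; last by rewrite eq_sym (negbTE ij).
by lia.
Qed.

Lemma num_x_ge_x2 n (b : joint 'I_n) i j :
  i != j -> is_x b i -> is_x b j -> (2 <= num_x b)%N.
Proof.
move=> ij bi bj; rewrite (num_x_flip_x bi).
by rewrite (@num_x_flip_x _ (flip b i) j) // is_x_flip eq_sym (negbTE ij).
Qed.

(* Largest size of a block of x-players whose growth the adversary can afford
   to resist at every step. *)
Definition guard_size (n k : nat) : nat := if (3 <= k)%N then (n - 2)%N else k.-1.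

(** Invariant of the path. An x-player without x-neighbours returns to y for free, and this exit
    would dominate guarded growth. Size 1 is exempt, since guarded growth is charged a factor there
    anyway. *)
Definition no_isolated_x n (b : joint 'I_n) : Prop :=
  (2 <= num_x b)%N -> forall i, is_x b i -> (0 < next_x b i)%N.

Lemma no_isolated_x_flip n (b : joint 'I_n) j :
  no_isolated_x b -> ~~ is_x b j -> (0 < next_x b j)%N ->
  no_isolated_x (flip b j).
Proof.
move=> nb bjX bj _ i; rewrite is_x_flip.
have flip_ge l : (next_x b l <= next_x (flip b j) l)%N.
  rewrite /next_x !is_x_flip; case: (eqVneq (ordS l) j) => [->|_];
  case: (eqVneq (ord_pred l) j) => [->|_]; rewrite ?(negbTE bjX) //=; lia.
have [->|ij] := eqVneq i j; first by move=> _; apply: leq_trans (flip_ge _).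
move=> /= bi; have [b2|b1] := leqP 2 (num_x b).
  by apply: leq_trans (flip_ge i); exact: nb.
have near_j l : is_x b l -> (l == ordS j) || (l == ord_pred j) -> i = l.
  move=> bl _; apply/eqP; apply: contraLR b1 => il.
  by rewrite -leqNgt (num_x_ge_x2 il).
rewrite /next_x !is_x_flip; move: bj; rewrite /next_x.
have [bS _|_] := boolP (is_x b (ordS j)).
  by rewrite (near_j _ bS) ?eqxx // ordSK eqxx (negbTE bjX) addnC.
have [bP _|//] := boolP (is_x b (ord_pred j)).
by rewrite (near_j _ bP) ?eqxx ?orbT // ord_predK eqxx (negbTE bjX).
Qed.

Section Below.
Variables (R : realType) (n k : nat) (n_ge3 : (3 <= n)%N).
Variables (alpha : R) (S : joint 'I_n -> {set 'I_n}) (beta : R).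
Hypotheses (beta_ge0 : 0 <= beta) (k_bnd : (1 <= k < n)%N) (S_k : MI_policy k S).
Implicit Types (a b : joint 'I_n) (i j : 'I_n).

Notation rate := (flip_rate (@ring_graph n) alpha S beta).
Notation gain := (gain alpha S).

(** A frontier player that is not influenced, or has two x-neighbours, flips at rate at least 1/2.
    If there is none, two distinct frontier players are influenced, so k is at least 2 and growth
    costs [1 - alpha]. Beyond the guard size this forces k = 2, and then every other exit is at
    least as costly, so no factor is lost relative to the outflow. *)
Lemma growth_step b : 2^-1 <= alpha -> alpha < 1 -> (0 < num_x b < n)%N -> no_isolated_x b -> exists j,
  [/\ ~~ is_x b j, no_isolated_x (flip b j) &
   expR (- (beta * (1 - alpha))) ^+ (num_x b <= guard_size n k)%N / (2 * n%:R) *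
     \sum_i rate b i <= rate b j].
Proof.
move=> alpha_ge alpha_lt1 b_bnd nb; have [bx by_] := num_x_between b_bnd.
have n0 : 0 < n%:R :> R by rewrite ltr0n (ltn_trans _ n_ge3).
have [/existsP[j /and3P[bjX bj jS]]|/existsPn all_guarded] := boolP [exists j,
    [&& ~~ is_x b j, (0 < next_x b j)%N & (j \notin S b) || (next_x b j == 2)%N]].
  exists j; split => //; first exact: no_isolated_x_flip.
  apply: (@le_trans _ _ 2^-1).
    rewrite mulrAC ler_pdivrMr ?mulr_gt0 // mulrA mulVf ?mul1r //.
    rewrite -[leRHS]mul1r ler_pM ?exprn_ge0 ?expR_ge0 ?sum_rate_le //.
      by rewrite sumr_ge0 // => i _; exact: rate_ge0.
    by rewrite exprn_ile1 ?expR_ge0 // expR_le1 oppr_le0 mulr_ge0 // subr_ge0 ltW.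
  apply: rate_ge_half => //; rewrite /gain (negbTE bjX).
  case/orP: jS => [/negbTE ->|/eqP ->]; last by case: (_ \in _); rewrite ?mulr1n ?mulr0n; lra.
  have : 1 <= (next_x b j)%:R :> R by rewrite ler1n.
  by move: (next_x b _)%:R => m; rewrite mulr0n; nra.
have guarded j : ~~ is_x b j -> (0 < next_x b j)%N -> j \in S b /\ next_x b j = 1%N.
  move=> bjX bj; have := all_guarded j; rewrite bjX bj /= negb_or negbK => /andP[-> j2].
  split=> //; move: bj j2; rewrite /next_x; by do 2 case: is_x.
have [i [bi biS]] := exists_xy bx by_.
have [j [bjX bjS]] := exists_yx bx by_.
have [jS j1] := guarded _ bjX (ltn_addr _ (eq_leq (esym (congr1 nat_of_bool bjS)))).
have [iS i1] : ordS i \in S b /\ next_x b (ordS i) = 1%N.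
  by apply: guarded => //; rewrite /next_x ordSK bi addn1.
have ij : ordS i != j.
  by apply/eqP => ij; move: j1; rewrite /next_x bjS -ij ordSK bi.
exists j; split => //; first by apply: no_isolated_x_flip => //; rewrite j1.
have rate_j : expR (- (beta * (1 - alpha))) / 2 <= rate b j.
  apply: rate_ge => //; first by rewrite subr_ge0 ltW.
  by rewrite /gain (negbTE bjX) j1 jS !mulr1n; lra.
set h := expR _ in rate_j *.
have h0 : 0 < h by exact: expR_gt0.
have Sij : [set ordS i; j] \subset S b.
  by apply/fintype.subsetP => l; rewrite !inE => /orP[] /eqP ->.
have k2 : (2 <= k)%N by rewrite -(S_k b) (leq_trans _ (subset_leq_card Sij)) ?cards2 ?ij.
have [le_g|gt_g] := leqP (num_x b) (guard_size n k).
  rewrite expr1 (le_trans _ rate_j) // mulrAC ler_pdivrMr ?mulr_gt0 //.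
  have -> : h / 2 * (2 * n%:R) = h * n%:R by field.
  by rewrite ler_wpM2l ?sum_rate_le ?ltW.
have b2 := num_x_le_y2 n_ge3 ij biS bjX.
move: gt_g; rewrite /guard_size; case: (leqP 3 k) => [k3|k3 b2']; first by rewrite ltnNge b2.
have kE : k = 2%N by apply/eqP; rewrite eqn_leq k2 -ltnS k3.
(* The whole budget sits on two y-players, so no x-player is influenced. *)
have SE : S b = [set ordS i; j].
  by apply/esym/eqP; rewrite eqEcard Sij S_k cards2 ij kE.
rewrite kE /= in b2'.
apply: le_trans rate_j; rewrite expr0 mul1r ler_pdivrMl ?mulr_gt0 //.
have -> : 2 * n%:R * (h / 2) = n%:R * h by field.
(* Every flip costs at least [1 - alpha]. For an x-player, which has an x-neighbour, the cost is at
   least [alpha]; here [2^-1 <= alpha] enters. *)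
apply: sum_ord_le => l; rewrite /h -mulrN; apply: rate_le => //.
rewrite /gain; case: ifP => bl.
  have -> : l \in S b = false.
    rewrite SE !inE; apply/negbTE; rewrite negb_or.
    by apply/andP; split; apply: contraTneq bl => ->.
  have : 1 <= (next_x b l)%:R :> R by rewrite ler1n; exact: nb.
  by move: (next_x b _)%:R => m; rewrite mulr0n; nra.
have [bl0|bl0] := posnP (next_x b l).
  by rewrite bl0; case: (_ \in _); rewrite ?mulr1n ?mulr0n; lra.
have [-> ->] := guarded l (negbT bl) bl0.
by rewrite !mulr1n; lra.
Qed.

Lemma ratio_below p : stationary (@ring_graph n) alpha S beta p ->
  2^-1 <= alpha -> alpha < 1 ->
  2 + (guard_size n k)%:R * (1 - alpha) <= 1 + 2 * alpha ->
  ((2 * n%:R) ^+ n)^-1 * p (all_y _) <= p (all_x _).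
Proof.
move=> p_stat alpha_ge alpha_lt1 thr; have [k1 kn] := andP k_bnd.
(* Since k < n, some player is free of influence at all-y and leaves at cost 2. *)
have /existsP[i0 i0S] : [exists i, i \notin S (all_y _)].
  rewrite -[[exists _, _]]negbK negb_exists; apply/negP => /forallP allS.
  move: kn; rewrite -(S_k (all_y _)) -[X in (_ < X)%N]card_ord ltnNge.
  by rewrite subset_leq_card //; apply/fintype.subsetP => i _; have := allS i; rewrite negbK.
apply: (ratio_of_flow n_ge3 beta_ge0 (good := @no_isolated_x n) (Q := 2)
  (J := guard_size n k) (r := 1 - alpha) (i0 := i0) p_stat) => //.
- by rewrite subr_ge0 ltW.
- by move=> b2; move: b2; rewrite num_x_flip_y ?num_x_all_y ?is_x_all_y.
- apply: rate_ge => //.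
  by rewrite /gain is_x_all_y next_x_all_y (negbTE i0S) /=; lra.
- by move=> b; exact: growth_step.
Qed.

End Below.

Lemma not_susceptible (R : realType) n k (alpha : R) : (3 <= n)%N ->
  (1 <= k < n)%N /\ (2^-1 <= alpha < 1) /\
    2 + (guard_size n k)%:R * (1 - alpha) <= 1 + 2 * alpha \/ 1 <= alpha ->
  ~ susceptible (@ring_graph n) k alpha.
Proof.
move=> n_ge3 thr [S [S_k]].
have n0 : 0 < ((2 * n%:R) ^+ n)^-1 :> R.
  by rewrite invr_gt0 exprn_gt0 // mulr_gt0 ?ltr0n ?(ltn_trans _ n_ge3).
apply: (not_stable_of_ratio n_ge3 n0) => beta p /ltW beta_ge0 p_stat.
case: thr => [[k_bnd [/andP[a1 a2] thr]]|a1]; last exact: ratio_alpha_ge1 p_stat a1.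
exact: (ratio_below n_ge3 beta_ge0 k_bnd S_k p_stat a1 a2 thr).
Qed.

(** * Threshold from below: a Lyapunov function *)

Lemma blocks_flip_x n (a : joint 'I_n) i : (3 <= n)%N ->
  is_x a i -> (next_x a i <= 1)%N -> (blocks (flip a i) <= blocks a)%N.
Proof.
move=> n_ge3 ai; have := blocks_flip n_ge3 a i; rewrite ai /next_x /=.
by do 2 case: is_x => //=; clear; lia.
Qed.

Lemma blocks_flip_y n (a : joint 'I_n) i : (3 <= n)%N ->
  ~~ is_x a i -> (blocks (flip a i) + next_x a i = (blocks a).+1)%N.
Proof.
move=> n_ge3 /negbTE ai; have := blocks_flip n_ge3 a i; rewrite ai /next_x /=.
by do 2 case: is_x => //=; clear; lia.
Qed.

(** The other terms add up to at most d/8, so the sum is at most -3d/8. This is the origin of the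
    factor [8 * n] separating the increments of the Lyapunov function. *)
Lemma sum_drift_le (R : realFieldType) n (T : 'I_n -> R) (d : R) i0 : 2 <= d ->
  (forall i, T i <= d / (8 * n%:R)) -> T i0 <= - (d / 2) -> \sum_i T i <= - 2^-1.
Proof.
move=> d2 T_le T0; have n0 : 0 < n%:R :> R by rewrite ltr0n (leq_ltn_trans _ (ltn_ord i0)).
rewrite (bigD1 i0) //=.
have : \sum_(i | i != i0) T i <= n%:R * (d / (8 * n%:R)).
  rewrite big_mkcond /=; apply: sum_ord_le => i; case: ifP => // _.
  by rewrite divr_ge0 ?mulr_ge0 ?ltW //; lra.
have -> : n%:R * (d / (8 * n%:R)) = d / 8 by field; rewrite gt_eqF.
by lra.
Qed.

Section Lyapunov.
Variables (R : realType) (n J : nat) (n_ge3 : (3 <= n)%N) (J_le : (J <= n - 2)%N).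
Variables (alpha : R) (S : joint 'I_n -> {set 'I_n}) (beta Q : R).
Implicit Types (a b : joint 'I_n) (i j : 'I_n).

Notation rate := (flip_rate (@ring_graph n) alpha S beta).
Notation gain := (gain alpha S).

(** [K] separates successive increments, [E] is the inverse rate of leaving all-x up to a constant,
    and [h] bounds the rate of guarded growth. *)
Let K : R := 8 * n%:R.
Let E : R := expR (beta * (1 + 2 * alpha)).
Let h : R := expR (- (beta * (1 - alpha))).

Hypotheses (beta_ge0 : 0 <= beta) (alpha_bnd : 0 < alpha < 1).
Hypothesis J_alpha : J%:R * (1 - alpha) <= 1.
Hypothesis beta_large : n%:R * K ^+ (2 * n) * h <= 1.
Hypothesis boundary_x : forall a, (0 < num_x a < n)%N -> exists i,
  [/\ is_x a i, (next_x a i <= 1)%N & (i \in S a) || (next_x a i == 0)%N].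
Hypothesis guarded : forall a, (0 < num_x a <= J)%N -> (blocks a <= 1)%N ->
  frontier a \subset S a.
Hypothesis infl_all_x : exists i, i \in S (all_x _).
Hypothesis rate_all_y : forall i, rate (all_y _) i <= expR (- (beta * Q)).

(* States with one small block of x-players: these are the states where the
   adversary makes growth costly. *)
Definition low a := (blocks a <= 1)%N && (num_x a <= J)%N.

(** Increments with respect to the size. Consecutive ones have ratio [1 / (K * h)] here, against
    growth at rate at most [h], and [1 / K] in [dhigh], where growth may be free. Thus one growing
    player contributes at most 1/K of what a returning boundary player removes. *)
Let dlow (j : nat) : R := E * K ^+ (2 * n + 1 - j) * h ^+ (J + 1 - j).
Let dhigh (j : nat) : R := E * K ^+ (n - j).
Let Dlow m : R := \sum_(1 <= j < m.+1) dlow j.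
Let Dhigh m : R := \sum_(1 <= j < m.+1) dhigh j.

(** The offset [E] dominates [Dlow], so falling from a high state to a low one only helps. The last
    increment [dhigh n] equals [E], which compensates the slow exit from all-x. *)
Definition lyapunov a : R :=
  if low a then Dlow (num_x a) else E + Dhigh (num_x a).

Let K_ge24 : 24 <= K.
Proof. by rewrite /K (_ : 24 = 8 * 3%:R) ?ler_pM2l ?ler_nat // -natrM. Qed.

Let K_ge1 : 1 <= K.
Proof. by apply: le_trans K_ge24; rewrite ler1n. Qed.

Let K_gt0 : 0 < K.
Proof. exact: lt_le_trans K_ge1. Qed.

Let E_ge1 : 1 <= E.
Proof.
rewrite -expR0 ler_expR mulr_ge0 //; have /andP[a0 _] := alpha_bnd.
by rewrite addr_ge0 // mulr_ge0 // ltW.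
Qed.

Let E_gt0 : 0 < E. Proof. exact: expR_gt0. Qed.
Let h_gt0 : 0 < h. Proof. exact: expR_gt0. Qed.

Let h_le1 : h <= 1.
Proof.
have /andP[_ a1] := alpha_bnd.
by rewrite expR_le1 oppr_le0 mulr_ge0 // subr_ge0 ltW.
Qed.

Let dlow_ge0 (j : nat) : 0 <= dlow j.
Proof. by rewrite !mulr_ge0 ?exprn_ge0 ?ltW. Qed.

Let dhigh_ge0 (j : nat) : 0 <= dhigh j.
Proof. by rewrite !mulr_ge0 ?exprn_ge0 ?ltW. Qed.

Let DlowS m : Dlow m.+1 = Dlow m + dlow m.+1.
Proof. by rewrite /Dlow big_nat_recr. Qed.

Let DhighS m : Dhigh m.+1 = Dhigh m + dhigh m.+1.
Proof. by rewrite /Dhigh big_nat_recr. Qed.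

Let Dlow_ge0 m : 0 <= Dlow m.
Proof. by apply: sumr_ge0 => j _. Qed.

Let Dhigh_ge0 m : 0 <= Dhigh m.
Proof. by apply: sumr_ge0 => j _. Qed.

Let J_le_n : (J <= n)%N. Proof. exact: leq_trans J_le (leq_subr _ _). Qed.

Let Dlow_le m : (m <= J)%N -> Dlow m <= E.
Proof.
move=> mJ; apply: (@le_trans _ _ (\sum_(1 <= j < m.+1) E * K ^+ (2 * n) * h)).
  apply: ler_sum_nat => j /andP[j1 jm].
  apply: ler_pM; rewrite ?mulr_ge0 ?exprn_ge0 ?(ltW E_gt0) ?(ltW K_gt0) ?(ltW h_gt0) //.
    by rewrite ler_pM2l // ler_weXn2l //; clear -j1; lia.
  rewrite -[leRHS]expr1; apply: ler_wiXn2l; rewrite ?(ltW h_gt0) //.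
  by rewrite addn1 subSn // (leq_trans _ mJ).
rewrite sumr_const_nat subn1 /= -mulr_natl.
apply: (@le_trans _ _ (E * (n%:R * K ^+ (2 * n) * h))); last first.
  by rewrite -[leRHS]mulr1 ler_pM2l.
have -> : m%:R * (E * K ^+ (2 * n) * h) = E * (m%:R * K ^+ (2 * n) * h).
  by rewrite -mulrA mulrCA !mulrA.
rewrite ler_pM2l // ler_pM2r // ler_wpM2r ?exprn_ge0 ?(ltW K_gt0) //.
by rewrite ler_nat (leq_trans mJ).
Qed.

Let Dhigh_le m : (m <= n)%N -> E + Dhigh m <= E * K ^+ n.
Proof.
move=> mn; have n_gt0 : (0 < n)%N by exact: leq_trans n_ge3.
have -> : E * K ^+ n = E * (8 * n%:R * K ^+ n.-1) by rewrite -exprS prednK.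
have K1 : 1 <= K ^+ n.-1 by apply: exprn_ege1.
apply: (@le_trans _ _ (E + E * (n%:R * K ^+ n.-1))).
  rewrite lerD2l; apply: (@le_trans _ _ (\sum_(1 <= j < m.+1) E * K ^+ n.-1)).
    apply: ler_sum_nat => j /andP[j1 jm].
    by rewrite ler_pM2l // ler_weXn2l //; clear -j1; lia.
  rewrite sumr_const_nat subn1 /= -(mulr_natl _ m) [leLHS]mulrCA ler_pM2l //.
  by rewrite ler_wpM2r ?(le_trans _ K1) // ler_nat.
rewrite -{1}[E]mulr1 -mulrDr ler_pM2l //.
have : 1 <= n%:R :> R by rewrite ler1n.
by move: (K ^+ _) K1 n%:R => x x1 y y1; nra.
Qed.

Lemma lyapunov_le a : lyapunov a <= E + Dhigh (num_x a).
Proof.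
rewrite /lyapunov; case: ifP => // /andP[_ aJ].
by apply: (le_trans (Dlow_le aJ)); rewrite lerDl.
Qed.

Lemma lyapunov_ge0 a : 0 <= lyapunov a.
Proof. by rewrite /lyapunov; case: ifP; rewrite ?addr_ge0 ?(ltW E_gt0). Qed.

Lemma lyapunov_le_top a : lyapunov a <= E * K ^+ n.
Proof. exact: le_trans (lyapunov_le _) (Dhigh_le (num_x_le a)). Qed.

Let drift a := \sum_i rate a i * (lyapunov (flip a i) - lyapunov a).

Lemma drift_all_x : drift (all_x _) <= - 2^-1.
Proof.
have [i0 i0S] := infl_all_x.
have lyap_x : lyapunov (all_x _) = E + Dhigh n.-1 + E.
  rewrite /lyapunov /low num_x_all_x.
  have -> : (n <= J)%N = false by clear -J_le n_ge3; lia.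
  have n1 : n = n.-1.+1 by rewrite prednK // (leq_trans _ n_ge3).
  by rewrite andbF {1}n1 DhighS -n1 /dhigh subnn mulr1 addrA.
have step i : lyapunov (flip (all_x _) i) - lyapunov (all_x _) <= - E.
  rewrite lyap_x; have := lyapunov_le (flip (all_x _) i).
  have : num_x (flip (all_x _) i) = n.-1.
    by rewrite -[LHS]/(_.+1.-1) -num_x_flip_x ?is_x_all_x // num_x_all_x.
  by move=> -> ?; lra.
have step0 i : rate (all_x _) i * (lyapunov (flip (all_x _) i) - lyapunov (all_x _)) <= 0.
  by rewrite mulr_ge0_le0 ?rate_ge0 // (le_trans (step i)) // oppr_le0 ltW.
rewrite /drift (bigD1 i0) //= -[leRHS]addr0 lerD ?sumr_le0 //.
have rate0 : E^-1 / 2 <= rate (all_x _) i0.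
  have /andP[a0 _] := alpha_bnd.
  rewrite -expRN; apply: rate_ge => //; first by lra.
  by rewrite /gain is_x_all_x next_x_all_x i0S mulr1n; lra.
apply: (@le_trans _ _ (E^-1 / 2 * - E)); last first.
  by rewrite mulrN mulrAC mulVf ?mul1r // gt_eqF.
rewrite -[leLHS]opprK -[leRHS]opprK lerN2 -!mulrN opprK.
by rewrite ler_pM ?divr_ge0 ?invr_ge0 ?(ltW E_gt0) // lerNr.
Qed.

(** The player given by [boundary_x] returns at rate at least 1/2 and removes a full increment; any
    growth adds at most the next one, smaller by a factor [K]. *)
Lemma drift_high a : (0 < num_x a < n)%N -> ~~ low a -> drift a <= - 2^-1.
Proof.
move=> a_bnd a_high; have /andP[a_gt0 a_lt] := a_bnd.
have [i0 [ai0 i0_next i0S]] := boundary_x a_bnd.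
have aS : num_x a = (num_x a).-1.+1 by rewrite prednK.
set m := (num_x a).-1 in aS.
have lyap_a : lyapunov a = E + Dhigh m + dhigh m.+1.
  by rewrite /lyapunov (negbTE a_high) aS DhighS addrA.
have step_x i : is_x a i -> lyapunov (flip a i) - lyapunov a <= - dhigh m.+1.
  move=> ai; have := lyapunov_le (flip a i); rewrite lyap_a.
  have -> : num_x (flip a i) = m by rewrite /m (num_x_flip_x ai).
  by move=> ?; lra.
have step_y i : ~~ is_x a i -> lyapunov (flip a i) - lyapunov a <= dhigh m.+2.
  move=> ai; have := lyapunov_le (flip a i); rewrite lyap_a.
  by rewrite (num_x_flip_y ai) aS !DhighS => ?; lra.
have dS : dhigh m.+2 = dhigh m.+1 / K.
  rewrite /dhigh (_ : (n - m.+1 = (n - m.+2).+1)%N); last first.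
    by rewrite subnSK // -aS.
  by rewrite exprSr mulrA mulfK // gt_eqF.
apply: (@sum_drift_le _ _ _ (dhigh m.+1) i0).
- rewrite -[2]mul1r ler_pM // (@le_trans _ _ K) //.
    by apply: le_trans K_ge24; rewrite ler_nat.
  by rewrite -[leLHS]expr1 ler_weXn2l // subn_gt0 -aS.
- move=> i; rewrite -/K; have [ai|ai] := boolP (is_x a i).
    apply: (@le_trans _ _ 0); last by rewrite divr_ge0 // ltW.
    by rewrite mulr_ge0_le0 ?rate_ge0 // (le_trans (step_x i ai)) // oppr_le0.
  rewrite -dS -[leRHS]mul1r.
  apply: (@le_trans _ _ (rate a i * dhigh m.+2)).
    by rewrite ler_wpM2l ?rate_ge0 ?step_y.
  by rewrite ler_wpM2r ?rate_le1.
apply: (@le_trans _ _ (rate a i0 * - dhigh m.+1)).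
  by rewrite ler_wpM2l ?rate_ge0 ?step_x.
rewrite mulrN lerN2 mulrC ler_wpM2r //; apply: rate_ge_half => //.
have /andP[al0 al1] := alpha_bnd.
rewrite /gain ai0; move: i0_next i0S.
case: (next_x a i0) => [|[|//]] _ => [_|]; last first.
  by rewrite orbF => ->; rewrite !mulr1n; lra.
by case: (_ \in _); rewrite ?mulr1n ?mulr0n; lra.
Qed.

Let Eh_ge1 : 1 <= E * h ^+ J.
Proof.
rewrite /h -expRM_natl -expRD -[leLHS]expR0 ler_expR.
have -> : beta * (1 + 2 * alpha) + J%:R * - (beta * (1 - alpha)) =
  beta * (1 + 2 * alpha - J%:R * (1 - alpha)) by ring.
have /andP[a0 _] := alpha_bnd; rewrite mulr_ge0 // subr_ge0.
by apply: (le_trans J_alpha); rewrite lerDl mulr_ge0 // ltW.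
Qed.

(** A boundary x-player returns at rate at least 1/2. The harmful flips are rare: splitting a block
    has rate at most [E^-1], a new isolated x-player at most [h ^+ J] because
    [J * (1 - alpha) <= 1], and growth at a guarded end at most [h]. *)
Lemma drift_low a : (0 < num_x a)%N -> low a -> drift a <= - 2^-1.
Proof.
move=> a_gt0 a_low; have /andP[a_blocks aJ] := a_low.
have a_bnd : (0 < num_x a < n)%N.
  by rewrite a_gt0; move: aJ; clear -J_le n_ge3; lia.
have gu : frontier a \subset S a by apply: guarded; rewrite ?a_gt0.
have [i0 [ai0 i0_next i0S]] := boundary_x a_bnd.
have aS : num_x a = (num_x a).-1.+1 by rewrite prednK.
set m := (num_x a).-1 in aS.
have mJ : (m < J)%N by rewrite -aS.
have lyap_a : lyapunov a = Dlow m + dlow m.+1.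
  by rewrite /lyapunov a_low aS DlowS.
have step_x i : is_x a i -> (next_x a i <= 1)%N ->
    lyapunov (flip a i) - lyapunov a = - dlow m.+1.
  move=> ai ai_next.
  have mi : num_x (flip a i) = m by rewrite /m (num_x_flip_x ai).
  rewrite lyap_a /lyapunov /low mi (ltnW mJ).
  by rewrite (leq_trans (blocks_flip_x n_ge3 ai ai_next)) //=; ring.
have step_top i : lyapunov (flip a i) - lyapunov a <= E * K ^+ n.
  by rewrite lerBlDr (le_trans (lyapunov_le_top _)) // lerDl lyapunov_ge0.
have dK : dlow m.+1 / K = E * K ^+ (2 * n - m.+1) * h ^+ (J - m).
  rewrite /dlow !addn1 (subSn (_ : m.+1 <= 2 * n)%N); last first.
    by clear -mJ J_le_n; lia.
  rewrite subSS exprSr; field; exact: lt0r_neq0.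
have top_le : E * h ^+ J * K ^+ n <= dlow m.+1 / K.
  rewrite dK -!mulrA ler_pM2l // mulrC ler_pM ?exprn_ge0 ?(ltW K_gt0) ?(ltW h_gt0) //.
    by rewrite ler_weXn2l //; clear -mJ J_le_n; lia.
  by rewrite ler_wiXn2l ?(ltW h_gt0) ?leq_subr.
have Kn_le : K ^+ n <= dlow m.+1 / K.
  by apply: le_trans top_le; rewrite ler_peMl ?exprn_ge0 ?(ltW K_gt0).
have /andP[al0 al1] := alpha_bnd.
(* For flips that may leave the low states, the jump is bounded by the maximum [E * K ^+ n] of the
   Lyapunov function. *)
have bound i r : 0 <= r -> rate a i <= r -> r * (E * K ^+ n) <= dlow m.+1 / K ->
    rate a i * (lyapunov (flip a i) - lyapunov a) <= dlow m.+1 / K.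
  move=> r0 ri; apply: le_trans.
  apply: (@le_trans _ _ (rate a i * (E * K ^+ n))).
    by rewrite ler_wpM2l ?rate_ge0.
  by rewrite ler_wpM2r // mulr_ge0 ?exprn_ge0 ?(ltW K_gt0) ?(ltW E_gt0).
apply: (@sum_drift_le _ _ _ (dlow m.+1) i0).
- rewrite -(ler_pM2r (_ : 0 < K^-1)) ?invr_gt0 //; apply: le_trans Kn_le.
  apply: (@le_trans _ _ 1); last exact: exprn_ege1.
  by rewrite ler_pdivrMr // mul1r; apply: le_trans K_ge24; rewrite ler_nat.
- move=> i; rewrite -/K; have [ai|ai] := boolP (is_x a i).
    have [ai1|ai2] := leqP (next_x a i) 1.
      rewrite step_x // mulrN (@le_trans _ _ 0) //.
        by rewrite oppr_le0 mulr_ge0 ?rate_ge0.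
      by rewrite divr_ge0 // ltW.
    have next2 : next_x a i = 2%N.
      by move: ai2; rewrite /next_x; do 2 case: is_x.
    apply: (@bound i E^-1); rewrite ?invr_ge0 ?(ltW E_gt0) //.
      rewrite -expRN -mulrN; apply: rate_le => //; rewrite /gain ai next2.
      by case: (_ \in _); rewrite ?mulr1n ?mulr0n; lra.
    by rewrite mulKf ?gt_eqF.
  have [next0|next_gt0] := posnP (next_x a i).
    apply: (@bound i (h ^+ J)); rewrite ?exprn_ge0 ?(ltW h_gt0) //; last first.
      by rewrite mulrA (mulrC _ E).
    rewrite /h -expRM_natl.
    have -> : J%:R * - (beta * (1 - alpha)) = beta * - (J%:R * (1 - alpha)) by ring.
    apply: rate_le => //; rewrite /gain (negbTE ai) next0.
    have := J_alpha; set z := J%:R * _ => z1.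
    by case: (_ \in _); rewrite ?mulr1n ?mulr0n; lra.
  have iS : i \in S a by apply: (fintype.subsetP gu); rewrite inE ai.
  (* With two x-neighbours the flip would close the only block into a full ring, impossible at size
     at most [n - 2]. *)
  have next1 : next_x a i = 1%N.
    have := blocks_flip_y n_ge3 ai; move: next_gt0 a_blocks.
    have : blocks (flip a i) != 0%N.
      apply: contraTneq a_bnd => /blocks_eq0[] E0.
        have := num_x_flip_y ai; rewrite E0 num_x_all_x.
        by move: aJ; clear -J_le n_ge3; lia.
      by have := num_x_flip_y ai; rewrite E0 num_x_all_y.
    by clear; lia.
  have rate_h : rate a i <= h.
    rewrite /h -mulrN; apply: rate_le => //; rewrite /gain (negbTE ai) next1 iS.
    by rewrite !mulr1n; lra.
  (* At size exactly [J] growth makes the state high; the single factor [h] in [dlow J] pays for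
     that jump. *)
  have [m1J|m1J] := leqP m.+2 J; last first.
    have JE : J = m.+1 by apply/eqP; rewrite eqn_leq mJ -ltnS m1J.
    apply: (@bound i h); rewrite ?(ltW h_gt0) //.
    rewrite dK JE subSnn expr1 mulrC ler_pM2r // ler_pM2l // ler_weXn2l //.
    by clear -mJ J_le_n; lia.
  have -> : lyapunov (flip a i) - lyapunov a = dlow m.+2.
    rewrite lyap_a /lyapunov /low (num_x_flip_y ai) aS m1J.
    have := blocks_flip_y n_ge3 ai; rewrite next1 addn1 => -[->].
    by rewrite a_blocks /= !DlowS; ring.
  apply: (@le_trans _ _ (h * dlow m.+2)); first by rewrite ler_wpM2r.
  by rewrite dK /dlow !addn1 !subSS mulrCA -exprS subnSK.
rewrite step_x // mulrN lerN2 mulrC ler_wpM2r //; apply: rate_ge_half => //.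
rewrite /gain ai0; move: i0_next i0S.
case: (next_x a i0) => [|[|//]] _ => [_|]; last first.
  by rewrite orbF => ->; rewrite !mulr1n; lra.
by case: (_ \in _); rewrite ?mulr1n ?mulr0n; lra.
Qed.

Lemma drift_all_y :
  drift (all_y _) <= n%:R * (expR (- (beta * Q)) * (E * K ^+ (2 * n) * h ^+ J)).
Proof.
apply: sum_ord_le => i.
have -> : lyapunov (all_y _) = 0.
  by rewrite /lyapunov /low num_x_all_y blocks_all_y /Dlow big_geq.
rewrite subr0; apply: ler_pM; [exact: rate_ge0|exact: lyapunov_ge0|exact: rate_all_y|].
have iX : ~~ is_x (all_y 'I_n) i by rewrite is_x_all_y.
(* For [J = 0] the first x-player already makes the state high; otherwise the jump is exactly
   [dlow 1]. *)
have [J0|J_gt0] := posnP J.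
  rewrite [X in h ^+ X]J0 mulr1 (le_trans (lyapunov_le_top _)) //.
  by rewrite ler_pM2l // ler_weXn2l // leq_pmull.
rewrite /lyapunov /low (num_x_flip_y iX) num_x_all_y J_gt0.
have := blocks_flip_y n_ge3 iX; rewrite next_x_all_y blocks_all_y addn0 => ->.
by rewrite /= /Dlow big_nat1 /dlow !addnK.
Qed.

(** The mean drift is zero, so the upward drift at all-y pays for the loss of at least [p b / 2] at
    [b]. *)
Lemma stationary_le p b : stationary (@ring_graph n) alpha S beta p ->
  b != all_y _ ->
  p b <= 2 * n%:R * K ^+ (2 * n) *
    expR (- (beta * (Q + J%:R * (1 - alpha) - (1 + 2 * alpha)))).
Proof.
move=> p_stat b_y; have [p0 p1 _] := p_stat.
have drift_neg a : a != all_y _ -> drift a <= - 2^-1.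
  move=> a_y; have [->|a_x] := eqVneq a (all_x _); first exact: drift_all_x.
  have a_gt0 : (0 < num_x a)%N.
    by rewrite lt0n; apply: contraNneq a_y => /num_x_eq0 ->.
  have [|a_high] := boolP (low a); first exact: drift_low.
  apply: drift_high => //; rewrite a_gt0 ltn_neqAle num_x_le andbT.
  by apply: contraNneq a_x => /num_x_eqn ->.
have n_gt0 : (0 < #|'I_n|)%N by rewrite card_ord (leq_trans _ n_ge3).
have := balance n_gt0 p_stat lyapunov; rewrite (bigD1 (all_y _)) //= (bigD1 b) //=.
set o := (X in _ + (_ + X)).
have o_le0 : o <= 0.
  apply: sumr_le0 => a /andP[a_y _]; rewrite mulr_ge0_le0 //.
  by apply: (le_trans (drift_neg a a_y)); rewrite oppr_le0.
have b_le : p b * drift b <= p b * - 2^-1 by rewrite ler_wpM2l // drift_neg.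
set eps := n%:R * (expR (- (beta * Q)) * (E * K ^+ (2 * n) * h ^+ J)).
have eps_ge0 : 0 <= eps.
  by rewrite !mulr_ge0 ?exprn_ge0 ?expR_ge0 ?(ltW K_gt0).
have y_le : p (all_y _) * drift (all_y _) <= eps.
  apply: (@le_trans _ _ (p (all_y _) * eps)); first by rewrite ler_wpM2l // drift_all_y.
  rewrite ler_piMl // -p1 (bigD1 (all_y _)) //= lerDl.
  by apply: sumr_ge0.
have -> : 2 * n%:R * K ^+ (2 * n) *
    expR (- (beta * (Q + J%:R * (1 - alpha) - (1 + 2 * alpha)))) = 2 * eps.
  rewrite /eps /E /h -expRM_natl.
  have -> : - (beta * (Q + J%:R * (1 - alpha) - (1 + 2 * alpha))) =
    - (beta * Q) + (beta * (1 + 2 * alpha) + J%:R * - (beta * (1 - alpha))) by ring.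
  by rewrite !expRD; ring.
by move: b_le y_le o_le0; rewrite /drift => b_le y_le o_le0 bal; lra.
Qed.

End Lyapunov.

(** * The adversary's policy and the threshold *)

Lemma cvg_expR_decay (R : realType) (tau : R) : 0 < tau ->
  (expR (- (beta * tau)) @[beta --> +oo] --> (0 : R))%classic.
Proof.
move=> tau_gt0.
have lim : (beta * tau @[beta --> +oo] --> +oo)%classic.
  by apply: gt0_cvgMly => //; exact: cvg_id.
exact: cvg_comp lim (@cvgr_expR R).
Qed.

(** The other states are finitely many and lose their mass exponentially fast, so [a0] keeps all of
    it in the limit. *)
Lemma stable_of_decay (R : realType) (V : finType) (e : rel V) (alpha : R) S
    (a0 : joint V) (C tau : R) :
  (0 < #|V|)%N -> 0 <= C -> 0 < tau ->
  (\forall beta \near +oo, forall p, stationary e alpha S beta p ->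
     forall b, b != a0 -> p b <= C * expR (- (beta * tau))) ->
  strictly_stochastically_stable e alpha S a0.
Proof.
move=> V_gt0 C_ge0 tau_gt0 decay.
pose p beta := projT1 (cid (@stationary_exists R V e alpha S beta V_gt0)).
have p_stat beta : stationary e alpha S beta (p beta).
  exact: projT2 (cid (@stationary_exists R V e alpha S beta V_gt0)).
have exp_cvg := cvg_expR_decay tau_gt0.
exists p, (fun b => if b == a0 then 1 else 0); split; last by rewrite eqxx.
  by move=> beta _; exact: p_stat.
move=> b; have [->|b_a0] /= := eqVneq b a0; last first.
  apply: (@squeeze_cvgr _ _ _ _ (fun=> 0) (fun beta => C * expR (- (beta * tau)))).
  - near=> beta; have [p0 _ _] := p_stat beta; rewrite p0 /=.
    near: beta; apply: filterS decay => beta; exact.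
  - exact: cvg_cst.
  - by rewrite -(mulr0 C); apply: cvgM exp_cvg; exact: cvg_cst.
pose N : R := #|joint V|%:R.
apply: (@squeeze_cvgr _ _ _ _ (fun beta => 1 - N * (C * expR (- (beta * tau)))) (fun=> 1)).
- near=> beta; have [p0 p1 _] := p_stat beta.
  have p1' := p1; rewrite (bigD1 a0) //= in p1'.
  apply/andP; split; last by rewrite -p1' lerDl sumr_ge0.
  rewrite -[X in X - _]p1' -addrA gerDl subr_le0.
  have -> : N * (C * expR (- (beta * tau))) = \sum_(b : joint V) C * expR (- (beta * tau)).
    by rewrite sumr_const -(mulr_natl _ #|_|).
  rewrite [leRHS](bigD1 a0) //= -[leLHS]add0r lerD ?mulr_ge0 ?expR_ge0 //.
  apply: ler_sum => b'; move: b'.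
  near: beta; apply: filterS decay => beta; exact.
- rewrite -[X in (_ --> X)%classic](subr0 1) -(mulr0 N) -(mulr0 C).
  apply: cvgB; first exact: cvg_cst.
  apply: cvgM; first exact: cvg_cst.
  by apply: cvgM exp_cvg; exact: cvg_cst.
- exact: cvg_cst.
Unshelve. all: by end_near.
Qed.

Lemma superset_of_card (V : finType) (T : {set V}) k :
  (#|T| <= k <= #|V|)%N -> exists2 A : {set V}, T \subset A & #|A| = k.
Proof.
move=> /andP[Tk]; rewrite -(subnKC Tk); elim: (k - #|T|)%N => [|m IH] mV.
  by exists T; rewrite ?addn0.
have [|A TA Am] := IH; first by apply: leq_trans mV; rewrite leq_add2l.
have /card_gt0P[i] : (0 < #|~: A|)%N.
  by rewrite cardsCs finset.setCK Am subn_gt0 -addnS.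
rewrite inE => iA; exists (i |: A); first exact: fintype.subset_trans (finset.subsetUr _ _).
by rewrite cardsU1 iA Am addnS.
Qed.

(** The adversary influences one x-player at a block end, and in small one-block states also the
    frontier, of at most two players. For k at least 3 all of them fit. For k = 2 the guarded state
    is a single x-player, which returns without influence; for k = 1 no state is guarded. *)
Lemma guard_policy n k J : (3 <= n)%N -> (1 <= k <= n)%N -> (J <= guard_size n k)%N ->
  (J <= n - 2)%N ->
  exists S : joint 'I_n -> {set 'I_n}, [/\ MI_policy k S,
    forall a, (0 < num_x a < n)%N -> exists i,
      [/\ is_x a i, (next_x a i <= 1)%N & (i \in S a) || (next_x a i == 0)%N] &
    forall a, (0 < num_x a <= J)%N -> (blocks a <= 1)%N -> frontier a \subset S a].
Proof.
move=> n_ge3 /andP[k_gt0 k_le] J_guard J_le.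
have supset (T : {set 'I_n}) : (#|T| <= k)%N ->
    exists2 A : {set 'I_n}, T \subset A & #|A| = k.
  by move=> Tk; apply: superset_of_card; rewrite Tk card_ord.
suff /choice[S S_spec] : forall a : joint 'I_n, exists A : {set 'I_n}, [/\ #|A| = k,
    (0 < num_x a < n)%N -> exists i,
      [/\ is_x a i, (next_x a i <= 1)%N & (i \in A) || (next_x a i == 0)%N] &
    (0 < num_x a <= J)%N -> (blocks a <= 1)%N -> frontier a \subset A].
  by exists S; split=> a; have [] := S_spec a.
move=> a; have [a_bnd|a_bnd] := boolP (0 < num_x a < n)%N; last first.
  have [|A _ Ak] := supset finset.set0; first by rewrite cards0.
  exists A; split=> // a_J; case/negP: a_bnd; move: a_J J_le n_ge3.
  by clear; lia.
have [a_x a_y] := num_x_between a_bnd.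
have [i [ai aiS]] := exists_xy a_x a_y.
have i_next : (next_x a i <= 1)%N by rewrite /next_x (negbTE aiS) leq_b1.
have [/andP[aJ a_blocks]|a_free] := boolP ((num_x a <= J) && (blocks a <= 1))%N; last first.
  have [|A iA Ak] := supset (finset.set1 i); first by rewrite cards1.
  exists A; split=> // [_|/andP[_ aJ] a_blocks]; last by rewrite aJ a_blocks in a_free.
  by exists i; split=> //; rewrite -finset.sub1set iA.
have front2 : (#|frontier a| <= 2)%N.
  by apply: leq_trans (card_frontier a) _; rewrite -[2%N]/(1.*2) leq_double.
have /andP[a_gt0 _] := a_bnd.
have [k3|k2] := leqP 3 k.
  have [|A iA Ak] := supset (i |: frontier a).
    by apply: leq_trans k3; rewrite cardsU1 (leq_add (leq_b1 _)).
  move: iA; rewrite finset.subUset finset.sub1set => /andP[iA frA].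
  by exists A; split=> // _; exists i; split=> //; rewrite iA.
move: J_guard; rewrite /guard_size (ltn_geF k2) => Jk.
have kE : k = 2%N by move: aJ a_gt0 Jk k2; clear; lia.
have [|A frA Ak] := supset (frontier a); first by rewrite kE.
exists A; split=> // _; exists i; split=> //; apply/orP; right.
have a1 : (num_x a < 2)%N by move: aJ Jk; rewrite kE; clear; lia.
rewrite /next_x (negbTE aiS) eqb0; apply: contraL a1 => aP.
by rewrite -leqNgt (num_x_ge_x2 (ord_pred_neq n_ge3 i)).
Qed.

Lemma susceptible_below (R : realType) n k J (alpha Q : R) : (3 <= n)%N ->
  (k < n)%N /\ (1 <= k)%N /\ J = guard_size n k /\ Q = 2 \/ k = n /\ J = 0%N /\ Q = 3 ->
  0 < alpha < 1 -> J%:R * (1 - alpha) <= 1 ->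
  1 + 2 * alpha < Q + J%:R * (1 - alpha) ->
  susceptible (@ring_graph n) k alpha.
Proof.
move=> n_ge3 cases alpha_bnd J_alpha thr.
have n_gt0 : (0 < n)%N by exact: leq_trans n_ge3.
have k_bnd : (1 <= k <= n)%N by case: cases => [[/ltnW-> [-> _]]|[-> _]] //; rewrite n_gt0 leqnn.
have J_guard : (J <= guard_size n k)%N by case: cases => [[_ [_ [-> _]]]|[_ [-> _]]].
have J_le : (J <= n - 2)%N.
  case: cases => [[kn [_ [-> _]]]|[_ [-> _]]] //; rewrite /guard_size.
  by case: leqP => // k3; move: k3 n_ge3; clear; lia.
have [S [S_k S_boundary S_guard]] := guard_policy n_ge3 k_bnd J_guard J_le.
exists S; split=> //.
pose K : R := 8 * n%:R.
pose tau := Q + J%:R * (1 - alpha) - (1 + 2 * alpha).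
have /andP[al0 al1] := alpha_bnd.
have al1' : 0 < 1 - alpha by rewrite subr_gt0.
have K_ge0 : 0 <= K by rewrite mulr_ge0.
apply: (@stable_of_decay _ _ _ _ _ _ (2 * n%:R * K ^+ (2 * n)) tau).
- by rewrite card_ord.
- by rewrite !mulr_ge0 ?exprn_ge0.
- by rewrite subr_gt0.
have large : (n%:R * K ^+ (2 * n) * expR (- (beta * (1 - alpha)))
    @[beta --> +oo] --> (0 : R))%classic.
  rewrite -[X in (_ --> X)%classic](mulr0 (n%:R * K ^+ (2 * n))).
  apply: cvgM; first exact: cvg_cst.
  exact: cvg_expR_decay.
near=> beta => p p_stat b b_y.
have beta_ge0 : 0 <= beta by near: beta; apply: nbhs_pinfty_ge; rewrite num_real.
apply: (stationary_le n_ge3 J_le beta_ge0 alpha_bnd J_alpha _ S_boundary S_guard) => //.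
- by near: beta; apply: (cvgr_le _ large).
- have /card_gt0P[i iS] : (0 < #|S (all_x _)|)%N by rewrite S_k; case/andP: k_bnd.
  by exists i.
move=> i; rewrite -mulrN; apply: rate_le => //; rewrite /gain is_x_all_y next_x_all_y.
(* Leaving all-y costs at least 2 under any policy, and 3 when k = n forces everybody to be
   influenced. *)
case: cases => [[_ [_ [_ ->]]]|[kn [_ ->]]].
  by case: (_ \in _); rewrite ?mulr1n ?mulr0n; lra.
have -> : i \in S (all_y _).
  have : S (all_y _) == finset.setT.
    by rewrite eqEcard finset.subsetT cardsT card_ord S_k kn leqnn.
  by move=> /eqP ->; rewrite inE.
by rewrite mulr1n mulr0n; lra.
Unshelve. all: by end_near.
Qed.

(** * The value of the supremum *)

Lemma alpha_sus_eq (R : realType) (V : finType) (e : rel V) k (lo thr : R) :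
  lo < thr -> (forall alpha, lo < alpha < thr -> susceptible e k alpha) ->
  (forall alpha, thr < alpha -> ~ susceptible e k alpha) ->
  alpha_sus R e k = thr%:E.
Proof.
move=> lo_thr below above; apply/eqP; rewrite eq_le; apply/andP; split.
  apply: ge_ereal_sup => _ [alpha /= sus <-]; rewrite lee_fin leNgt.
  by apply/negP => /above; exact.
apply/lee_addgt0Pr => eps eps_gt0.
pose d := Num.min eps ((thr - lo) / 2).
have d_eps : d <= eps by rewrite ge_min lexx.
have d_lo : d <= (thr - lo) / 2 by rewrite ge_min lexx orbT.
have d_gt0 : 0 < d by rewrite lt_min eps_gt0 divr_gt0 // subr_gt0.
apply: (@le_trans _ _ ((thr - d)%:E + eps%:E)%E).
  by rewrite -EFinD lee_fin; lra.
rewrite leeD2r //; apply: ereal_sup_ubound; exists (thr - d) => //=.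
by apply: below; apply/andP; split; lra.
Qed.

(** The value solves [1 + 2 * alpha = 2 + J * (1 - alpha)]. *)
Lemma alpha_sus_lt_n (R : realType) n k : (3 <= n)%N -> (1 <= k < n)%N ->
  alpha_sus R (@ring_graph n) k =
    (((guard_size n k).+1)%:R / ((guard_size n k).+2)%:R)%:E.
Proof.
move=> n_ge3 k_bnd; have /andP[k_gt0 kn] := k_bnd.
set J := guard_size n k; pose j : R := J%:R.
have j0 : 0 <= j by exact: ler0n.
have -> : J.+1%:R = j + 1 :> R by rewrite -natr1.
have -> : J.+2%:R = j + 2 :> R by rewrite -addn2 natrD.
have j1 : 0 < j + 1 by lra.
have j2 : 0 < j + 2 by lra.
(* Above this lower end [alpha] is positive and [J * (1 - alpha) <= 1], as the Lyapunov argument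
   requires. *)
apply: (@alpha_sus_eq _ _ _ _ (j / (j + 1))).
- by rewrite ltr_pdivrMr // mulrAC ltr_pdivlMr //; nra.
- move=> alpha /andP[]; rewrite ltr_pdivrMr // ltr_pdivlMr // => lo hi.
  apply: (@susceptible_below _ _ _ J alpha 2) => //.
  + by left.
  + by apply/andP; split; nra.
  + by rewrite -/j; nra.
  + by rewrite -/j; nra.
move=> alpha; rewrite ltr_pdivrMr // => hi; apply: not_susceptible => //.
have [al1|al1] := ltP alpha 1; [left|by right].
by split=> //; rewrite -/J -/j; split; [apply/andP; split|]; nra.
Qed.

Lemma alpha_sus_n (R : realType) n : (3 <= n)%N ->
  alpha_sus R (@ring_graph n) n = 1%:E.
Proof.
move=> n_ge3; apply: (@alpha_sus_eq _ _ _ _ 0) => // [alpha alpha_bnd|alpha al1].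
  have /andP[al0 al1] := alpha_bnd.
  (* With everybody influenced the exit from all-y costs 3, and [1 + 2 * alpha < 3] holds without
     any guarded growth. *)
  apply: (@susceptible_below _ _ _ 0%N alpha 3) => //; first by right.
    by rewrite mul0r.
  by lra.
by apply: not_susceptible => //; right; exact: ltW.
Qed.

Theorem theorem6 (R : realType) (n k : nat) (hn : (3 <= n)%N)
    (hk : (1 <= k <= n)%N) :
  alpha_sus R (@ring_graph n) k =
    (if (k \in [:: 1; 2]%N) && (k <= n.-1)%N then k%:R / (k%:R + 1)
     else if (3 <= k <= n.-1)%N then (n%:R - 1) / n%:R
     else 1)%:E.
Proof.
have /andP[k_gt0 k_le] := hk.
have n_gt0 : (0 < n)%N by exact: leq_trans hn.
have [kn|] := ltnP k n; last first.
  move=> n_le; have -> : k = n by apply/eqP; rewrite eqn_leq k_le n_le.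
  have -> : (n <= n.-1)%N = false by rewrite -ltnS prednK // ltnn.
  by rewrite !andbF alpha_sus_n.
rewrite alpha_sus_lt_n ?k_gt0 // /guard_size.
have -> : (k <= n.-1)%N by rewrite -ltnS prednK.
rewrite !andbT !inE; have [k3|k3] := leqP 3 k.
  have -> : (k == 1%N) || (k == 2%N) = false by move: k3; clear; lia.
  have -> : (n - 2).+2 = n by move: hn; clear; lia.
  have -> : (n - 2).+1 = (n - 1)%N by move: hn; clear; lia.
  by rewrite natrB.
have -> : (k == 1%N) || (k == 2%N) by move: k3 k_gt0; clear; lia.
by rewrite prednK // -natr1.
Qed.
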